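(* Let $a<b$ be real numbers and let $f:\mathbb{R}\to\mathbb{R}$ be unimodal on $[a,b]$ with minimum point $x^*\in[a,b]$. Let $\varepsilon_D$ (respectively $\varepsilon_T$) be the accuracy with which the interval halving method (respectively the trichotomy method), started on $[a,b]$, finds the minimum point $x^*$ after using $N$ calculations of the values of the minimized function $f$. Then $$\varepsilon_D\le \frac{b-a}{2\cdot 2^{\frac{N-1}{2}}},\qquad \varepsilon_T\le \frac{b-a}{2\cdot 3^{\frac{N-1}{4}}}.$$
   Context: Unimodality: $f$ is unimodal on $[a,b]$ with minimum point $x^*\in[a,b]$ if for all $a\le x_1<x_2\le b$: $x_2<x^*$ implies $f(x_1)>f(x_2)$, and $x_1>x^*$ implies $f(x_2)>f(x_1)$. Both methods maintain a current interval of uncertainty $[\alpha,\beta]$, initially $[a,b]$, and iterate. The midpoint of the last interval of uncertainty obtained is taken as the approximation of $x^*$, and the accuracy ($\varepsilon_D$ or $\varepsilon_T$) is the error, i.e. the distance from this midpoint to $x^*$. The value of $f$ at the midpoint of $[a,b]$ is calculated in the first iteration; in each later iteration the midpoint of the current interval is a point at which the value of $f$ is already known, and this value is reused and not calculated (or counted) again. All other values of $f$ that appear in an iteration are calculated, once each, only when needed in the branch followed. One iteration of the interval halving method on $[\alpha,\beta]$: let $x_2=\frac{\alpha+\beta}{2}$ (with $f(x_2)$ known, or calculated in the first iteration). Put $x_1=\frac{\alpha+x_2}{2}$ and calculate $f(x_1)$. If $f(x_1)\le f(x_2)$, the new interval is $[\alpha,x_2]$ (midpoint $x_1$). Otherwise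 put $x_3=\frac{x_2+\beta}{2}$ and calculate $f(x_3)$; if $f(x_2)\le f(x_3)$, the new interval is $[x_1,x_3]$ (midpoint $x_2$), else it is $[x_2,\beta]$ (midpoint $x_3$). One iteration of the trichotomy method on $[\alpha,\beta]$: let $x_3=\frac{\alpha+\beta}{2}$ (with $f(x_3)$ known, or calculated in the first iteration). Put $x_2=\frac{\alpha+2x_3}{3}$ and calculate $f(x_2)$. - If $f(x_2)\le f(x_3)$, put $x_1=\frac{\alpha+x_2}{2}$ and calculate $f(x_1)$; if $f(x_1)\le f(x_2)$, the new interval is $[\alpha,x_2]$ (midpoint $x_1$), else it is $[x_1,x_3]$ (midpoint $x_2$). - If $f(x_2)>f(x_3)$, put $x_4=\frac{\beta+2x_3}{3}$ and calculate $f(x_4)$. If $f(x_4)\le f(x_3)$, put $x_5=\frac{2\beta+x_3}{3}$ and calculate $f(x_5)$; if $f(x_5)\le f(x_4)$, the new interval is $[x_4,\beta]$ (midpoint $x_5$), else it is $[x_3,x_5]$ (midpoint $x_4$). If $f(x_4)>f(x_3)$, the new interval is $[x_2,x_4]$ (midpoint $x_3$). *)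

(* Defs.v *)
From Stdlib Require Import Reals.
Local Open Scope R_scope.

Definition unimodal (f : R -> R) (a b xs : R) : Prop :=
  a <= xs <= b /\
  forall x1 x2 : R, a <= x1 -> x1 < x2 -> x2 <= b ->
    (x2 < xs -> f x1 > f x2) /\ (x1 > xs -> f x2 > f x1).

(** [mid_val] caches the value of [f] at the midpoint of [[lo, hi]]: it is
    [None] only before the first iteration.  [calcs] counts all calculations
    of values of [f] made so far. *)
Record state : Type := State {
  lo : R;
  hi : R;
  mid_val : option R;
  calcs : nat
}.

Definition midpoint (s : state) : R := (lo s + hi s) / 2.

Definition init (a b : R) : state := State a b None 0.

(** The value of [f] at the midpoint, paired with the updated count: reusing a
    cached value is free, otherwise one calculation is charged. *)
Definition get_mid (f : R -> R) (s : state) : R * nat :=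
  match mid_val s with
  | Some y => (y, calcs s)
  | None => (f (midpoint s), S (calcs s))
  end.

(** In the two step functions below, the last field of each resulting state
    charges one calculation per [y_i := f x_i] bound on the branch followed. *)
Definition halving_step (f : R -> R) (s : state) : state :=
  let x2 := midpoint s in
  let (y2, n) := get_mid f s in
  let x1 := (lo s + x2) / 2 in
  let y1 := f x1 in
  if Rle_dec y1 y2 then State (lo s) x2 (Some y1) (n + 1)
  else
    let x3 := (x2 + hi s) / 2 in
    let y3 := f x3 in
    if Rle_dec y2 y3 then State x1 x3 (Some y2) (n + 2)
    else State x2 (hi s) (Some y3) (n + 2).

Definition trichotomy_step (f : R -> R) (s : state) : state :=
  let x3 := midpoint s in
  let (y3, n) := get_mid f s in
  let x2 := (lo s + 2 * x3) / 3 in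
  let y2 := f x2 in
  if Rle_dec y2 y3 then
    let x1 := (lo s + x2) / 2 in
    let y1 := f x1 in
    if Rle_dec y1 y2 then State (lo s) x2 (Some y1) (n + 2)
    else State x1 x3 (Some y2) (n + 2)
  else
    let x4 := (hi s + 2 * x3) / 3 in
    let y4 := f x4 in
    if Rle_dec y4 y3 then
      let x5 := (2 * hi s + x3) / 3 in
      let y5 := f x5 in
      if Rle_dec y5 y4 then State x4 (hi s) (Some y5) (n + 3)
      else State x3 x5 (Some y4) (n + 3)
    else State x2 x4 (Some y3) (n + 2).

(** [eps] is the error of the method with iteration [step], started on
    [[a, b]], when some number of completed iterations has used exactly [N]
    calculations of values of [f].  No interval of uncertainty is produced in
    the middle of an iteration, so only completed iterations are considered. *)
Definition accuracy_after (step : (R -> R) -> state -> state)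
    (f : R -> R) (a b xs : R) (N : nat) (eps : R) : Prop :=
  exists k : nat,
    let s := Nat.iter k (step f) (init a b) in
    calcs s = N /\ eps = Rabs (midpoint s - xs).

(* Main.v *)
(** Each iteration keeps [x^*] in the interval of uncertainty, divides the length
of that interval by [c], and calculates at most [d] new values, where
[(c, d) = (2, 2)] for halving and [(3, 4)] for trichotomy (3 values already
suffice there).  The first iteration also calculates the value at the midpoint
of [[a, b]]; charging this value in advance, [c ^ ((n - 1) / d)] times the length
does not exceed [b - a], where [n] is the number of values charged, and the
midpoint is at most half a length away from [x^*]. *)

Require Import Defs.
From Stdlib Require Import Reals Lra Lia.
Open Scope R_scope.

(** Were [xs] strictly beyond [v] as seen from [u], [f] would strictly decrease from [u] to [v]. *)
Lemma unimodal_compare (f : R -> R) (a b xs u v : R) :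
  unimodal f a b xs -> a <= u <= b -> a <= v <= b -> f u <= f v ->
  (u < v -> xs <= v) /\ (v < u -> v <= xs).
Proof.
  intros [_ Hf] Hu Hv Hle; split; intros Huv; apply Rnot_lt_le; intros Hlt.
  - destruct (Hf u v ltac:(lra) Huv ltac:(lra)) as [Hdec _]; lra.
  - destruct (Hf v u ltac:(lra) Huv ltac:(lra)) as [_ Hinc]; lra.
Qed.

(** The loop invariant. Its first conjunct says that a cached value is genuine; it is trivial when
    nothing is cached. *)
Definition localizes (f : R -> R) (a b xs : R) (s : state) : Prop :=
  fst (get_mid f s) = f (midpoint s) /\
  a <= lo s /\ hi s <= b /\ lo s < hi s /\ lo s <= xs <= hi s.

(** [snd (get_mid f s)] is the count with the value at the midpoint charged in
    advance: it differs from [calcs s] only before the first iteration. *)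
Definition contracts (f : R -> R) (c : R) (d : nat) (s s' : state) : Prop :=
  hi s' - lo s' = (hi s - lo s) / c /\
  (snd (get_mid f s') <= snd (get_mid f s) + d)%nat.

Definition contracting (step : (R -> R) -> state -> state) (f : R -> R)
    (a b xs c : R) (d : nat) : Prop :=
  forall s, localizes f a b xs s ->
    localizes f a b xs (step f s) /\ contracts f c d s (step f s).

(** Each test outcome, weakened to a non-strict inequality, bounds [xs] on one side; the rest is
    linear arithmetic. [f_equal] handles the cached value, whose argument is the new midpoint. *)
Ltac solve_branch f Hf :=
  repeat match goal with
  | H : ~ f _ <= f _ |- _ => apply Rnot_le_lt, Rlt_le in H
  end;
  repeat match goal with
  | H : f ?u <= f ?v |- _ =>
      let Hl := fresh in let Hr := fresh in
      destruct (unimodal_compare f _ _ _ u v Hf ltac:(lra) ltac:(lra) H)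
        as [Hl Hr]; clear H;
      first [specialize (Hl ltac:(lra)) | clear Hl];
      first [specialize (Hr ltac:(lra)) | clear Hr]
  end;
  unfold localizes, midpoint; cbn [get_mid mid_val lo hi calcs fst snd];
  repeat split; first [lra | lia | f_equal; lra].

Lemma halving_contracting (f : R -> R) (a b xs : R) :
  unimodal f a b xs -> contracting halving_step f a b xs 2 2.
Proof.
  intros Hf [l h m n0] (Hmid & Hal & Hhb & Hlh & Hx).
  unfold contracts, halving_step.
  destruct (get_mid f _) as [y n]; cbn [fst snd] in *; subst y.
  unfold midpoint in *; cbn [lo hi] in *.
  destruct (Rle_dec _ _) as [H1 | H1]; [solve_branch f Hf |].
  destruct (Rle_dec _ _) as [H2 | H2]; solve_branch f Hf.
Qed.

Lemma trichotomy_contracting (f : R -> R) (a b xs : R) :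
  unimodal f a b xs -> contracting trichotomy_step f a b xs 3 4.
Proof.
  intros Hf [l h m n0] (Hmid & Hal & Hhb & Hlh & Hx).
  unfold contracts, trichotomy_step.
  destruct (get_mid f _) as [y n]; cbn [fst snd] in *; subst y.
  unfold midpoint in *; cbn [lo hi] in *.
  destruct (Rle_dec _ _) as [H1 | H1];
    destruct (Rle_dec _ _) as [H2 | H2]; try solve [solve_branch f Hf].
  (* Only the branch that calculates [f] at [x5] has a third test. *)
  destruct (Rle_dec _ _) as [H3 | H3]; solve_branch f Hf.
Qed.

Lemma length_bound (step : (R -> R) -> state -> state) (f : R -> R)
    (a b xs c : R) (d k : nat) :
  1 < c -> (0 < d)%nat -> a < b -> a <= xs <= b ->
  contracting step f a b xs c d ->
  let s := Nat.iter k (step f) (init a b) in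
  localizes f a b xs s /\
  (hi s - lo s) * Rpower c ((INR (snd (get_mid f s)) - 1) / INR d) <= b - a.
Proof.
  intros Hc Hd Hab Hxs Hstep; simpl.
  assert (HD : 0 < INR d) by (apply lt_0_INR; lia).
  induction k as [| k [Hloc IH]].
  - unfold localizes; simpl.
    (* The midpoint value charged in advance makes the initial count 1, so the exponent vanishes. *)
    replace ((1 - 1) / INR d) with 0 by (field; lra).
    rewrite Rpower_O by lra.
    repeat split; lra.
  - cbn [Nat.iter nat_rect].
    fold (Nat.iter k (step f) (init a b)).
    set (s := Nat.iter k (step f) (init a b)) in *.
    destruct (Hstep s Hloc) as [Hloc' [Hlen Hn]].
    split; [exact Hloc' |].
    rewrite Hlen.
    apply le_INR in Hn; rewrite plus_INR in Hn.
    apply Rle_trans with (2 := IH).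
    (* Charging [d] more values multiplies the power by exactly [c], which offsets the division of
       the length by [c]. *)
    replace (Rpower c ((INR (snd (get_mid f s)) - 1) / INR d))
      with (Rpower c ((INR (snd (get_mid f s)) + INR d - 1) / INR d) / c).
    + unfold Rdiv at 1 3; rewrite (Rmult_comm (Rpower _ _) (/ c)), <- Rmult_assoc.
      apply Rmult_le_compat_l.
      * destruct Hloc as (_ & _ & _ & Hlh & _).
        apply Rlt_le, Rmult_lt_0_compat; [lra | apply Rinv_0_lt_compat; lra].
      * apply Rle_Rpower; [lra |].
        apply Rmult_le_compat_r; [apply Rlt_le, Rinv_0_lt_compat, HD | lra].
    + replace ((INR (snd (get_mid f s)) + INR d - 1) / INR d)
        with ((INR (snd (get_mid f s)) - 1) / INR d + 1) by (field; lra).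
      rewrite Rpower_plus, Rpower_1 by lra.
      field; lra.
Qed.

Lemma accuracy_bound (step : (R -> R) -> state -> state) (f : R -> R)
    (a b xs c eps : R) (d N : nat) :
  1 < c -> (0 < d)%nat -> a < b -> a <= xs <= b ->
  contracting step f a b xs c d ->
  accuracy_after step f a b xs N eps ->
  eps <= (b - a) / (2 * Rpower c ((INR N - 1) / INR d)).
Proof.
  intros Hc Hd Hab Hxs Hstep [k [HN Heps]].
  destruct (length_bound step f a b xs c d k Hc Hd Hab Hxs Hstep) as [Hloc Hlen].
  set (s := Nat.iter k (step f) (init a b)) in *.
  destruct Hloc as (_ & _ & _ & Hlh & Hx).
  assert (HD : 0 < / INR d) by (apply Rinv_0_lt_compat, lt_0_INR; lia).
  (* An inequality suffices, as the power grows with the count; it is strict only for [k = 0], where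
     [N = 0] and one value is charged. *)
  assert (Hcalcs : (N <= snd (get_mid f s))%nat)
    by (unfold get_mid; destruct (mid_val s); simpl; lia).
  apply le_INR in Hcalcs.
  assert (Hpow : Rpower c ((INR N - 1) / INR d)
      <= Rpower c ((INR (snd (get_mid f s)) - 1) / INR d)).
  { apply Rle_Rpower; [lra |]. apply Rmult_le_compat_r; lra. }
  set (p := Rpower c ((INR N - 1) / INR d)) in *.
  assert (Hp : 0 < p) by apply exp_pos.
  assert (Hhalf : eps <= (hi s - lo s) / 2)
    by (rewrite Heps; unfold midpoint; apply Rabs_le; lra).
  assert (Hlenp : (hi s - lo s) * p <= b - a).
  { apply Rle_trans with (2 := Hlen). apply Rmult_le_compat_l; lra. }
  apply Rle_trans with (1 := Hhalf).
  apply Rmult_le_reg_r with (2 * p); [lra |].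
  replace ((b - a) / (2 * p) * (2 * p)) with (b - a) by (field; lra).
  lra.
Qed.

Theorem proposition2 (a b : R) (f : R -> R) (xs : R)
    (hab : a < b) (hf : unimodal f a b xs) (N : nat) :
  (forall epsD : R, accuracy_after halving_step f a b xs N epsD ->
     epsD <= (b - a) / (2 * Rpower 2 ((INR N - 1) / 2))) /\
  (forall epsT : R, accuracy_after trichotomy_step f a b xs N epsT ->
     epsT <= (b - a) / (2 * Rpower 3 ((INR N - 1) / 4))).
Proof.
  pose proof (proj1 hf) as Hxs.
  split; intros eps Heps.
  - replace ((INR N - 1) / 2) with ((INR N - 1) / INR 2) by (simpl; lra).
    eapply accuracy_bound; eauto using halving_contracting; lra || lia.
  - replace ((INR N - 1) / 4) with ((INR N - 1) / INR 4) by (simpl; lra).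
    eapply accuracy_bound; eauto using trichotomy_contracting; lra || lia.
Qed.
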